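(* For every even positive integer $k \le 2 \cdot 10^{100}$, the equation $\phi(n+k) = \phi(n)$ has at least six distinct solutions $n$ in positive integers.
   Context: $\phi$ denotes Euler's Phi function: $\phi(n)$ is the number of positive integers less than or equal to $n$ that are coprime with $n$. Here $k$ is fixed and $n$ is the unknown. *)

(* Defs.v *)
From mathcomp Require Export all_boot.
Set Implicit Arguments.
Unset Strict Implicit.
Unset Printing Implicit Defensive.

(* Main.v *)
(** If [k] is even, [p] and [q = 2 p - 1] are odd primes, and neither divides
    [k], then [n = q k] is a solution: [phi (q k) = (2 p - 2) phi k] and
    [phi (q k + k) = phi (2 k p) = 2 (p - 1) phi k].  There are 38 such pairs
    with [2^11 <= p < 2^12 - 1 <= q], and the 76 primes are distinct.  Every
    pair with a member dividing [k] contributes a factor at least [2^11] to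
    [k]; as [k < 2^341], at most 30 pairs are lost in this way. *)
Require Import Defs.
From mathcomp Require Import all_boot.

Lemma double_predn_inj : {in ltn 0 &, injective (fun p => (p.*2).-1)}.
Proof.
move=> p r p_gt0 r_gt0 /(congr1 succn).
by rewrite !prednK ?double_gt0 // => /double_inj.
Qed.

(** The exponent of [p] in [k] is already positive, and raising a positive exponent by one
    multiplies the totient of the prime power by [p]. *)
Lemma totient_mul_prime_dvd p k :
  prime p -> 0 < k -> p %| k -> totient (p * k) = p * totient k.
Proof.
move=> p_pr k_gt0 p_dv_k.
have [m p_m ->] := pfactor_coprime p_pr k_gt0.
have e_gt0 : 0 < logn p k by rewrite logn_gt0 mem_primes p_pr k_gt0.
have m_pX e : coprime m (p ^ e) by rewrite coprimeXr // coprime_sym.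
rewrite mulnCA -expnS !totient_coprime // !totient_pfactor //=.
by rewrite -{1}(prednK e_gt0) expnS (mulnCA p.-1) mulnCA.
Qed.

Lemma totient_mul_prime_ndvd p k :
  prime p -> ~~ (p %| k) -> totient (p * k) = p.-1 * totient k.
Proof.
by move=> p_pr p_k; rewrite totient_coprime ?prime_coprime // totient_prime.
Qed.

Lemma prod_primes_dvdn (s : seq nat) k :
  uniq s -> (forall q, q \in s -> prime q && (q %| k)) -> \prod_(q <- s) q %| k.
Proof.
elim: s => [|q s IHs] /=; first by rewrite big_nil dvd1n.
case/andP=> q_s s_uniq s_k; rewrite big_cons.
have /andP[q_pr q_k] := s_k q (mem_head q s).
have s_k' r : r \in s -> prime r && (r %| k).
  by move=> r_s; apply: s_k; rewrite in_cons r_s orbT.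
rewrite Gauss_dvd ?q_k ?IHs // prime_coprime // Euclid_dvd_prod //.
apply/negP; rewrite big_has => /hasP[r r_s].
have /andP[r_pr _] := s_k' r r_s.
by rewrite dvdn_prime2 // => /eqP q_r; rewrite q_r r_s in q_s.
Qed.

Lemma totient_add_twice_predn p k :
  prime p -> prime (p.*2).-1 -> 2 < p -> 0 < k -> ~~ odd k ->
  ~~ (p %| k) -> ~~ ((p.*2).-1 %| k) ->
  totient ((p.*2).-1 * k + k) = totient ((p.*2).-1 * k).
Proof.
move=> p_pr q_pr p_gt2 k_gt0 k_even p_k q_k.
have p_2k : ~~ (p %| 2 * k).
  by rewrite Euclid_dvdM // negb_or p_k andbT gtnNdvd.
rewrite [RHS]totient_mul_prime_ndvd // -mulSnr prednK ?double_gt0 ?prime_gt0 //.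
(* Peel [p] off [p * (2 * k)], then 2 off [2 * k]: since [k] is even, the latter doubles the
   totient. *)
rewrite -muln2 -mulnA totient_mul_prime_ndvd // totient_mul_prime_dvd ?dvdn2 //.
by rewrite mulnA !muln2 double_pred.
Qed.

Definition spoiled k p := (p %| k) || ((p.*2).-1 %| k).

(** The bounds give [p < 2 N - 1 <= 2 r - 1] for all [p], [r] in [L], so no prime occurs twice among
    the pairs, and the product of those dividing [k] divides [k]. *)
Lemma leq_exp_count_spoiled (L : seq nat) N k : 0 < k -> uniq L ->
    (forall p, p \in L ->
      [/\ prime p, prime (p.*2).-1, N <= p & p < (N.*2).-1]) ->
  N ^ count (spoiled k) L <= k.
Proof.
move=> k_gt0 L_uniq L_pr; pose f p := (p.*2).-1.
have f_mono p r : p <= r -> f p <= f r by move=> p_r; rewrite /f -!subn1 leq_sub2r ?leq_double.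
pose s := [seq q <- L ++ map f L | q %| k].
have s_k : \prod_(q <- s) q %| k.
  apply: prod_primes_dvdn => [|q].
    rewrite filter_uniq // cat_uniq L_uniq /=; apply/andP; split.
      apply/hasPn=> _ /mapP[p /L_pr[_ _ p_ge _] ->].
      apply/negP=> /L_pr[_ _ _]; apply/negP; rewrite -leqNgt.
      exact: f_mono.
    rewrite map_inj_in_uniq // => p r.
    move=> /L_pr[/prime_gt0 p_gt0 _ _ _] /L_pr[/prime_gt0 r_gt0 _ _ _].
    exact: double_predn_inj.
  rewrite mem_filter mem_cat => /andP[-> /orP[/L_pr[-> //]|]].
  by case/mapP=> p /L_pr[_ ? _ _] ->; rewrite andbT.
apply: leq_trans (dvdn_leq k_gt0 s_k).
(* Regroup the product by pairs: the members dividing [k] contribute at least [N] if the pair is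
   spoiled, and 1 otherwise. *)
rewrite big_filter big_cat big_map /= 2![\prod_(_ <- _ | _) _]big_mkcond /=.
rewrite -big_split -iter_muln_1 -big_const_seq big_mkcond /=.
rewrite big_seq [leqRHS]big_seq; apply: leq_prod => p.
case/L_pr=> /prime_gt0 p_gt0 /prime_gt0 q_gt0 p_ge _.
have q_ge : p <= f p by rewrite -ltnS prednK ?double_gt0 // -addnn -addn1 leq_add2l.
rewrite /spoiled; case: (p %| k) => /=.
  by apply: leq_trans p_ge _; case: ifP; rewrite ?muln1 ?leq_pmulr.
by case: ifP; rewrite mul1n //= (leq_trans p_ge).
Qed.

Lemma prime_pairs_2048 : exists L : seq nat,
  [/\ uniq L, size L = 38
    & forall p, p \in L ->
      [/\ prime p, prime (p.*2).-1, 2048 <= p & p < (2048.*2).-1]].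
Proof.
(* The interval ends at 4094, the last value below [2 * 2048 - 1]. *)
exists [seq p <- iota 2048 2047 | prime p && prime (p.*2).-1]; split.
- exact: filter_uniq (iota_uniq _ _).
- by vm_cast_no_check (erefl 38).
- by move=> p; rewrite mem_filter mem_iota => /andP[/andP[? ?] /andP[? ?]].
Qed.

(* The exponent stays a variable so that no tactic evaluates the powers in
   unary. *)
Lemma ltn_pow10_pow2 e : 2 * 10 ^ (3 * e).+1 < 2 ^ (10 * e + 6).
Proof.
(* This is [10 ^ 3 <= 2 ^ 10] raised to the power [e]; the remaining factor [2 * 10] is below
   [2 ^ 6]. *)
have le_pow : 10 ^ (3 * e) <= 2 ^ (10 * e).
  by rewrite !expnM; case: e => // e; rewrite leq_exp2r.
rewrite expnS mulnA expnD mulnC (leq_ltn_trans (leq_mul le_pow (leqnn _))) //.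
by rewrite ltn_mul2l expn_gt0.
Qed.

Lemma ltn_pow10_100 : 2 * 10 ^ 100 < 2048 ^ 31.
Proof.
(* The choice [e = 33] gives [3 * e + 1 = 100]; the exponents of 2 are 336 and 341. *)
have e336 : 10 * 33 + 6 <= 11 * 31 by [].
have le_pow2 := leq_pexp2l (isT : 0 < 2) e336.
rewrite (expnM 2 11 31) in le_pow2.
exact: leq_trans (ltn_pow10_pow2 33) le_pow2.
Qed.

Theorem theorem2 (k : nat) (k_gt0 : 0 < k) (k_even : ~~ odd k)
    (k_le : k <= 2 * 10 ^ 100) :
  exists s : seq nat,
    [/\ uniq s, 6 <= size s
      & forall n, n \in s -> 0 < n /\ totient (n + k) = totient n].
Proof.
have [L [L_uniq L_size L_pr]] := prime_pairs_2048.
exists [seq (p.*2).-1 * k | p <- L & ~~ spoiled k p]; split.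
- rewrite map_inj_in_uniq ?filter_uniq // => p r; rewrite !mem_filter.
  move=> /andP[_ /L_pr[/prime_gt0 p_gt0 _ _ _]].
  move=> /andP[_ /L_pr[/prime_gt0 r_gt0 _ _ _]] /eqP.
  rewrite eqn_pmul2r // => /eqP; exact: double_predn_inj.
- rewrite size_map size_filter.
  have few : count (spoiled k) L < 31.
    rewrite -(ltn_exp2l _ _ (isT : 1 < 2048)).
    have le_k := leq_exp_count_spoiled _ _ _ k_gt0 L_uniq L_pr.
    exact: leq_ltn_trans le_k (leq_ltn_trans k_le ltn_pow10_100).
  have total := count_predC (spoiled k) L.
  (* At most 5 good and 30 spoiled pairs would account for only 35 of the 38. *)
  rewrite leqNgt; apply/negP=> good.
  by have := leq_add few good; rewrite addSn addnS total L_size.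
- move=> n /mapP[p]; rewrite mem_filter negb_or => /andP[/andP[p_k q_k]].
  case/L_pr=> p_pr q_pr p_ge _ ->.
  rewrite muln_gt0 k_gt0 prime_gt0 //; split=> //.
  by apply: totient_add_twice_predn => //; apply: leq_trans p_ge.
Qed.
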